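(* Let $A\in\mathbb{Z}^{d\times n}$. The completion algorithm described in the context, applied to $A$, terminates (whatever choices are made when selecting elements $s\in C$ and when selecting reducing elements $g\in G$ in the normal form procedure), and it returns a finite set $G\subseteq\mathbb{Z}^d$ such that $\{Q^I_{A,b}:b\in G\}$ contains all extended atomic fibers of $A$.
   Context: For $u,v\in\mathbb{R}^n$ write $u\sqsubseteq v$ if $u^{(j)}v^{(j)}\ge 0$ and $|u^{(j)}|\le |v^{(j)}|$ for all components $j=1,\dots,n$. For $S,T,U\subseteq\mathbb{R}^n$ write $S=T\oplus U$ if for every $z\in S$ there are $z_1\in T$ and $z_2\in U$ with $z_1\sqsubseteq z$, $z_2\sqsubseteq z$ and $z=z_1+z_2$. For $A\in\mathbb{Z}^{d\times n}$ and $b\in\mathbb{Z}^d$, the extended fiber of $b$ is $Q^I_{A,b}:=\{z\in\mathbb{Z}^n: Az=b\}$. The extended fiber $Q^I_{A,b}$ is called atomic (an extended atomic fiber of $A$) if it cannot be written as $Q^I_{A,b}=Q^I_{A,b_1}\oplus Q^I_{A,b_2}$ with two other extended fibers $Q^I_{A,b_1}$, $Q^I_{A,b_2}$ (i.e. with $b_1,b_2\in\mathbb{Z}^d$, $b_1\ne b$ and $b_2\neq b$). In particular, empty extended fibers are not atomic, since they decompose vacuously. Normal form procedure $\mathrm{normalForm}(s,G)$, for $s\in\mathbb{Z}^d$ and a finite $G\subseteq\mathbb{Z}^d$: while there is some $g\in G$ such that $Q^I_{A,s}=Q^I_{A,g}\oplus Q^I_{A,s-g}$, replace $s$ by $s-g$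 for such a $g$; when no such $g$ exists, return $s$. Completion algorithm. Let $e_1,\dots,e_n$ be the unit vectors of $\mathbb{R}^n$. Input: $F:=\{Ae_1,\dots,Ae_n,-Ae_1,\dots,-Ae_n\}\setminus\{0\}$. (1) Set $G:=F$ and $C:=\{f+g: f,g\in G\}$ (the case $f=g$ is included). (2) While $C\ne\emptyset$: choose an element $s\in C$; set $C:=C\setminus\{s\}$; compute $f:=\mathrm{normalForm}(s,G)$; if $f\neq 0$, set $G:=G\cup\{f\}$ and then $C:=C\cup\{f+g: g\in G\}$ (with the updated $G$). (3) Set $G:=G\cup\{0\}$ and return $G$. *)

(* Defs.v *)
From HB Require Import structures.
From Stdlib Require Export Relation_Operators.
From mathcomp Require Export all_boot all_order all_algebra finmap.
From mathcomp Require Export classical_sets.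
Set Implicit Arguments.
Unset Strict Implicit.
Unset Printing Implicit Defensive.
Import Order.TTheory GRing.Theory Num.Theory.
Local Open Scope classical_set_scope.
Local Open Scope ring_scope.

(* Stated over any ordered domain: R^n and Z^n are both instances, and the
   fibers below only contain integer vectors. *)
Definition sqle (R : realDomainType) (n : nat) (u v : 'cV[R]_n) : Prop :=
  forall j, 0 <= u j 0 * v j 0 /\ `|u j 0| <= `|v j 0|.

(* "S = T (+) U". Only the elements of S are constrained: sums of elements of
   T and U need not lie in S. *)
Definition is_oplus (R : realDomainType) (n : nat) (S T U : set 'cV[R]_n) :
    Prop :=
  forall z, S z -> exists z1 z2,
    [/\ T z1, U z2, sqle z1 z, sqle z2 z & z = z1 + z2].

Definition extfiber (d n : nat) (A : 'M[int]_(d, n)) (b : 'cV[int]_d) :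
    set 'cV[int]_n :=
  [set z | A *m z = b].

Definition atomic (d n : nat) (A : 'M[int]_(d, n)) : set 'cV[int]_d :=
  [set b | ~ exists b1 b2, [/\ b1 <> b, b2 <> b &
             is_oplus (extfiber A b) (extfiber A b1) (extfiber A b2)]].

Definition reduces (d n : nat) (A : 'M[int]_(d, n)) (s g : 'cV[int]_d) : Prop :=
  is_oplus (extfiber A s) (extfiber A g) (extfiber A (s - g)).

(* The algorithm is a nondeterministic transition system, so that termination
   also covers the inner loop of the normal form procedure.
   [Loop G C] is the head of the outer while loop, [NormalForm G C s] is the head
   of the while loop of normalForm(s, G), and [Return G] is the exit. *)
Inductive state (d : nat) : Type :=
| Loop of {fset 'cV[int]_d} & {fset 'cV[int]_d}
| NormalForm of {fset 'cV[int]_d} & {fset 'cV[int]_d} & 'cV[int]_d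
| Return of {fset 'cV[int]_d}.

Inductive step (d n : nat) (A : 'M[int]_(d, n)) : state d -> state d -> Prop :=
| StepChoose (G C : {fset 'cV[int]_d}) (s : 'cV[int]_d) :
    s \in C -> step A (Loop G C) (NormalForm G (C `\ s)%fset s)
| StepReduce (G C : {fset 'cV[int]_d}) (s g : 'cV[int]_d) :
    g \in G -> reduces A s g ->
    step A (NormalForm G C s) (NormalForm G C (s - g))
| StepZero (G C : {fset 'cV[int]_d}) (f : 'cV[int]_d) :
    (forall g : 'cV[int]_d, g \in G -> ~ reduces A f g) -> f = 0 ->
    step A (NormalForm G C f) (Loop G C)
| StepAdd (G C : {fset 'cV[int]_d}) (f : 'cV[int]_d) :
    (forall g : 'cV[int]_d, g \in G -> ~ reduces A f g) -> f <> 0 ->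
    let G' := (f |` G)%fset in
    step A (NormalForm G C f)
           (Loop G' (C `|` [fset (f + g)%R | g in G'])%fset)
| StepReturn (G : {fset 'cV[int]_d}) :
    step A (Loop G fset0) (Return (0 |` G)%fset).

Definition input (d n : nat) (A : 'M[int]_(d, n)) : {fset 'cV[int]_d} :=
  (([fset (A *m delta_mx j (0 : 'I_1))%R | j in 'I_n]
    `|` [fset (- (A *m delta_mx j (0 : 'I_1)))%R | j in 'I_n]) `\ 0%R)%fset.

Definition init (d n : nat) (A : 'M[int]_(d, n)) : state d :=
  let F := input A in Loop F [fset (f + g)%R | f in F, g in F]%fset.

Definition reachable (d n : nat) (A : 'M[int]_(d, n)) (x : state d) : Prop :=
  clos_refl_trans (state d) (step A) (init A) x.

Definition halted (d n : nat) (A : 'M[int]_(d, n)) (x : state d) : Prop :=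
  forall y, ~ step A x y.

(* Strong normalization of the initial state: accessibility for the converse of
   [step], so every sequence of choices leads to a finite run. *)
Definition terminates (d n : nat) (A : 'M[int]_(d, n)) : Prop :=
  Acc (fun y x => step A x y) (init A).

(* Main.v *)
(* Termination. "g reduces s" means that every point of the fiber of s lies above
   a point of the fiber of g for [sqle]; by Maclagan's theorem every infinite
   sequence of fibers has an earlier term reducing a later one, so only finitely
   many elements are added. Maclagan's theorem is obtained from a nonprincipal
   ultrafilter U on nat: for a double sequence v of naturals,
   v i k <= v k j for U-most i, k, j, and such inequalities can be intersected
   over finitely many coordinates. Each normal form computation stops because it
   decreases the least l1 norm on the fiber.

   Correctness. On return every f + g with f, g in G splits conformally, uniformly
   over its fiber, into elements of G. Given b <> 0 with nonempty fiber, take the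
   finitely many sqle-minimal points of the fiber and write b as a sum of elements
   of G, with a matching splitting of each minimal point, so that the total l1 norm
   is least. Replacing a non-conformal pair of summands by the splitting of its sum
   would lower the norm, so every summand g reduces b; if b is atomic, then b = g. *)
Require Import Defs.
From Stdlib Require Import Inverse_Image.
From mathcomp Require Import boolp filter zify.
Set Implicit Arguments.
Unset Strict Implicit.
Unset Printing Implicit Defensive.
Import Order.TTheory GRing.Theory Num.Theory.
Local Open Scope classical_set_scope.
Local Open Scope ring_scope.

(** * Maclagan's theorem for double sequences *)

Lemma ultra_iterated_le (U : set_system nat) (v : nat -> nat -> nat) :
  UltraFilter U ->
  \forall i \near U, \forall k \near U, \forall j \near U, (v i k <= v k j)%N.
Proof.
move=> FU.
set P := fun i k => \forall j \near U, (v i k <= v k j)%N.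
have nP i k : ~ P i k -> \forall j \near U, (v k j < v i k)%N.
  case: (in_ultra_setVsetC [set j | (v i k <= v k j)%N] FU) => [//|h _].
  by apply: filterS h => j /= /negP; rewrite -ltnNge.
(* If the claim fails, the failing rows form a set [S] in [U]: for [i] in [S] and U-most [k], row
   [k] is eventually below [v i k]. *)
case: (in_ultra_setVsetC [set i | \forall k \near U, P i k] FU) => // hS.
set S := ~` _ in hS.
have SnP i : S i -> \forall k \near U, ~ P i k.
  by case: (in_ultra_setVsetC [set k | P i k] FU).
(* Descent on a bound [x] for the tail of a row [v i] with [i] in [S]. *)
have noS x : forall i, S i -> ~ \forall k \near U, (v i k < x)%N.
  elim/ltn_ind: x => x IH i Si hx.
  have [k [[/nP Pk Sk] /= kx]] := filter_ex (filterI (filterI (SnP i Si) hS) hx).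
  exact: IH kx k Sk Pk.
have [i Si] := filter_ex hS.
have [k [/nP Pk Sk]] := filter_ex (filterI (SnP i Si) hS).
by case: (noS _ _ Sk Pk).
Qed.

(** Positive and negative parts turn [sqle] into a product order on naturals, indexed by sign and
    coordinate; [Negz m] stands for [-(m+1)]. *)
Definition signed_part (s : bool) (x : int) : nat :=
  match x, s with Posz m, true => m | Negz m, false => m.+1 | _, _ => 0%N end.

Lemma sqleP (n : nat) (u v : 'cV[int]_n) :
  sqle u v <->
  forall s j, (signed_part s (u j 0%R) <= signed_part s (v j 0%R))%N.
Proof.
split=> [h s j|h j]; last (have := h true j; have := h false j).
  by have [] := h j; case: s; case: (u j 0) => a; case: (v j 0) => c /=; nia.
by case: (u j 0) => a; case: (v j 0) => c /= *; split; nia.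
Qed.

(** Doubly indexed because in [reduces_good] the witness of a failed reduction depends on a pair of
    indices. As [U] refines the cofinite filter, the indices can be chosen increasing. *)
Lemma double_sequence_sqle (n : nat) (u : nat -> nat -> 'cV[int]_n) :
  exists i k j, [/\ (i < k)%N, (k < j)%N & sqle (u i k) (u k j)].
Proof.
have [U [FU oU]] := ultraFilterLemma eventually_filter.
have gtU m : U [set k | (m < k)%N] by apply: oU; exists m.+1.
have hU (c : bool * 'I_n) : \forall i \near U, \forall k \near U, \forall j \near U,
    (signed_part c.1 (u i k c.2 0%R) <= signed_part c.1 (u k j c.2 0%R))%N.
  exact: (ultra_iterated_le (fun i k => signed_part c.1 (u i k c.2 0))).
have [i hi] := filter_ex (filter_forall _ hU).
have [k [hk ik]] := filter_ex (filterI (filter_forall _ hi) (gtU i)).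
have [j [hj kj]] := filter_ex (filterI (filter_forall _ hk) (gtU k)).
exists i, k, j; split => //; apply/sqleP => s c.
exact: (hj (s, c)).
Qed.

(** Otherwise choice yields an infinite chain of inaccessible sets, and the fresh elements of its
    stages form a sequence without a good pair. Being about sets, this measures both the lists in
    [sqle_basis] and the sets [G] of the algorithm. *)
Lemma bad_extension_wf (T : Type) (good : T -> T -> Prop) :
  (forall u : nat -> T, exists i j, (i < j)%N /\ good (u i) (u j)) ->
  well_founded (fun Y X : set T =>
    X `<=` Y /\ exists2 z, Y z & forall x, X x -> ~ good x z).
Proof.
set R := (X in well_founded X) => hgood X0; apply: contrapT => nacc0.
have /choice[f hf] (X : {X | ~ Acc R X}) :
    exists Y : {X | ~ Acc R X}, R (sval Y) (sval X).
  case: X => X nacc /=; apply: contrapT => nY; apply: nacc; split=> Y RY.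
  by apply: contrapT => naccY; apply: nY; exists (exist _ Y naccY).
pose X i := sval (iter i f (exist _ X0 nacc0)).
have /choice[u hu] i : exists z, X i.+1 z /\ forall x, X i x -> ~ good x z.
  by have [_ [z ? ?]] := hf (iter i f (exist _ X0 nacc0)); exists z.
have Xmono i j : (i <= j)%N -> X i `<=` X j.
  move/subnK <-; elim: (j - i)%N => // m IH x /IH.
  by have [h _] := hf (iter (m + i) f (exist _ X0 nacc0)); exact: h.
have [i [j [ij]]] := hgood u; case: (hu j) => _; apply.
by apply: Xmono ij _ _; case: (hu i).
Qed.

Lemma sqle_basis (n : nat) (X : set 'cV[int]_n) :
  exists2 L : seq 'cV[int]_n, [set` L] `<=` X &
    forall z, X z -> exists2 w, w \in L & sqle w z.
Proof.
have wf : well_founded (fun Y X : set 'cV[int]_n =>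
    X `<=` Y /\ exists2 z, Y z & forall x, X x -> ~ sqle x z).
  apply: bad_extension_wf => u.
  (* The rows are constant, which leaves the single-sequence statement. *)
  by have [i [k [j [_ kj h]]]] := double_sequence_sqle (fun=> u); exists k, j.
suff h (L : seq 'cV[int]_n) : [set` L] `<=` X ->
    exists2 M : seq 'cV[int]_n, [set` M] `<=` X &
      forall z, X z -> exists2 w, w \in M & sqle w z.
  by apply: (h [::]).
elim/(well_founded_ind (wf_inverse_image _ _ _ (fun L : seq 'cV_n => [set` L]) wf)): L.
move=> L IH LX; apply: contrapT => nL.
have [z Xz nz] : exists2 z, X z & forall w, w \in L -> ~ sqle w z.
  apply: contrapT => h; apply: nL; exists L => // z Xz.
  apply: contrapT => nw; apply: h; exists z => // w wL wz.
  by apply: nw; exists w.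
apply/nL/(IH (z :: L)).
  split; first by move=> w /= wL; rewrite inE wL orbT.
  by exists z => //=; rewrite inE eqxx.
by move=> w /=; rewrite inE => /orP[/eqP-> //|]; exact: LX.
Qed.

(** * Conformal order and the l1 norm *)

Lemma sqle_trans (n : nat) (u v w : 'cV[int]_n) :
  sqle u v -> sqle v w -> sqle u w.
Proof.
by move=> /sqleP uv /sqleP vw; apply/sqleP => s j; apply: leq_trans (vw s j).
Qed.

Lemma sqle_subr (n : nat) (u v : 'cV[int]_n) : sqle u v -> sqle (v - u) v.
Proof.
move=> uv j; have := uv j; rewrite !mxE.
by move: (u j 0) (v j 0) => [a|a] [c|c] [? ?]; split; nia.
Qed.

Lemma sqle_addr (n : nat) (u v : 'cV[int]_n) :
  (forall j, 0 <= u j 0 * v j 0) -> sqle u (u + v).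
Proof.
move=> uv j; have := uv j; rewrite !mxE.
by move: (u j 0) (v j 0) => [a|a] [c|c] ?; split; nia.
Qed.

Definition l1 (n : nat) (z : 'cV[int]_n) : nat := (\sum_j `|z j 0%R|)%N.

Lemma l1_eq0 (n : nat) (z : 'cV[int]_n) : l1 z = 0%N -> z = 0.
Proof.
move/eqP; rewrite sum_nat_eq0 => /forallP h; apply/matrixP=> i j.
by rewrite ord1 mxE; have := h i; rewrite absz_eq0 => /eqP.
Qed.

Lemma l1D (n : nat) (u v : 'cV[int]_n) : (l1 (u + v) <= l1 u + l1 v)%N.
Proof.
rewrite -big_split; apply: leq_sum => j _ /=; rewrite !mxE.
by move: (u j 0) (v j 0) => x y; lia.
Qed.

Lemma l1_sqle (n : nat) (u v : 'cV[int]_n) :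
  sqle u v -> l1 v = (l1 u + l1 (v - u))%N.
Proof.
move=> uv; rewrite -big_split; apply: eq_bigr => j _ /=.
have := uv j; rewrite !mxE.
by move: (u j 0) (v j 0) => [a|a] [c|c] [? ?]; nia.
Qed.

(** Opposite signs in coordinate [j] lose norm strictly there, while the other coordinates obey the
    triangle inequality. Thus the norm detects non-conformal pairs. *)
Lemma l1D_sign (n : nat) (u v : 'cV[int]_n) :
  (l1 u + l1 v <= l1 (u + v))%N -> forall j, 0 <= u j 0 * v j 0.
Proof.
move=> h j; apply: contraT => uvj; move: h; rewrite leqNgt => /negP; case.
rewrite -big_split /l1 [ltnLHS](bigD1 j) //= [ltnRHS](bigD1 j) //= -addSn.
apply: leq_add.
  by rewrite mxE; move: (u j 0) (v j 0) uvj => [a|a] [c|c]; nia.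
by apply: leq_sum => i _; rewrite mxE; move: (u i 0) (v i 0) => x y; lia.
Qed.

(** * Reductions and uniform splittings of fibers *)

Lemma reducesP (d n : nat) (A : 'M[int]_(d, n)) (s g : 'cV[int]_d) :
  reduces A s g <->
  forall z, A *m z = s -> exists2 w, A *m w = g & sqle w z.
Proof.
split=> [h z /h[w [_ [? _ ? _ _]]]|h z sz]; first by exists w.
have [w Aw wz] := h z sz; exists w, (z - w); split=> //.
- by rewrite /extfiber /= mulmxBr sz Aw.
- exact: sqle_subr.
- by rewrite addrC subrK.
Qed.

(** If no pair reduces, every [i < j] has a point [z (i, j)] in the fiber of [b j] lying above no
    point of the fiber of [b i]. A comparison of [z (i, k)] with [z (k, j)] contradicts this, since
    [z (i, k)] is in the fiber of [b k]. *)
Lemma reduces_good (d n : nat) (A : 'M[int]_(d, n)) (b : nat -> 'cV[int]_d) :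
  exists i j, (i < j)%N /\ reduces A (b j) (b i).
Proof.
apply: contrapT => nb.
have /choice[z hz] (ij : nat * nat) : exists z, (ij.1 < ij.2)%N ->
    A *m z = b ij.2 /\ forall w, A *m w = b ij.1 -> ~ sqle w z.
  case: ij => i j /=; have [ij|_] := ltnP i j; last by exists 0.
  apply: contrapT => nz; apply: nb; exists i, j; split=> //.
  apply/reducesP => z Az; apply: contrapT => nw; apply: nz; exists z => _.
  by split=> // w Aw wz; apply: nw; exists w.
have [i [k [j [ik kj]]]] := double_sequence_sqle (fun i j => z (i, j)).
by apply: (hz (k, j) kj).2; exact: (hz (i, k) ik).1.
Qed.

(* A summand [g] of the common splitting is paired with the map sending each
   [z] in [X] to its component in the fiber of [g]. *)
Definition splits (d n : nat) (A : 'M[int]_(d, n)) (G : {fset 'cV[int]_d})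
    (X : set 'cV[int]_n)
    (R : seq ('cV[int]_d * ('cV[int]_n -> 'cV[int]_n))) : Prop :=
  (forall p, p \in R -> p.1 \in G /\ forall z, X z -> A *m p.2 z = p.1) /\
  forall z, X z -> \sum_(p <- R) p.2 z = z.

(** The components sum to [z], so the triangle inequality gives the reverse bound: the norm
    condition says that no signs cancel within the splitting. *)
Definition resolvable (d n : nat) (A : 'M[int]_(d, n))
    (G : {fset 'cV[int]_d}) (s : 'cV[int]_d) : Prop :=
  exists2 R, splits A G (extfiber A s) R &
    forall z, A *m z = s -> (\sum_(p <- R) l1 (p.2 z) <= l1 z)%N.

Lemma resolvable_mem (d n : nat) (A : 'M[int]_(d, n))
    (G : {fset 'cV[int]_d}) (g : 'cV[int]_d) :
  g \in G -> resolvable A G g.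
Proof.
move=> gG; exists [:: (g, id)]; last by move=> z _; rewrite big_seq1.
by split=> [p|z _]; [rewrite inE => /eqP-> | rewrite big_seq1].
Qed.

Lemma resolvable_sub (d n : nat) (A : 'M[int]_(d, n))
    (G G' : {fset 'cV[int]_d}) (s : 'cV[int]_d) :
  (G `<=` G')%fset -> resolvable A G s -> resolvable A G' s.
Proof.
move=> GG' [R [RG RS] Rl]; exists R => //; split=> // p /RG[pG ?].
by split=> //; apply: (fsubsetP GG').
Qed.

(** Choose [h z] in the fiber of [g] below [z] and split [z - h z] by the given splitting; norms add
    because [h z] is conformal to [z]. *)
Lemma resolvable_reduces (d n : nat) (A : 'M[int]_(d, n))
    (G : {fset 'cV[int]_d}) (s g : 'cV[int]_d) :
  g \in G -> reduces A s g -> resolvable A G (s - g) -> resolvable A G s.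
Proof.
move=> gG /reducesP sg [R [RG RS] Rl].
have /choice[h hP] z : exists w, A *m z = s -> A *m w = g /\ sqle w z.
  have [/sg[w]|] := EM (A *m z = s); first by exists w.
  by exists 0.
have Ah z : A *m z = s -> A *m (z - h z) = s - g.
  by move=> sz; rewrite mulmxBr sz (hP z sz).1.
exists ((g, h) :: [seq (p.1, fun z => p.2 (z - h z)) | p <- R]).
  split=> [p|z sz].
    rewrite inE => /orP[/eqP->|/mapP[q qR ->]] /=.
      by split=> // z /hP[].
    have [qG hq] := RG q qR; split=> // z sz.
    by apply: hq; exact: Ah.
  by rewrite big_cons big_map /= RS; [rewrite addrC subrK | exact: Ah].
move=> z sz; rewrite big_cons big_map /= (l1_sqle (hP z sz).2) leq_add2l.
exact/Rl/Ah.
Qed.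

Lemma splits_perm (d n : nat) (A : 'M[int]_(d, n)) (G : {fset 'cV[int]_d})
    (X : set 'cV[int]_n) R R' :
  perm_eq R R' -> splits A G X R -> splits A G X R'.
Proof.
move=> RR' [RG RS]; split=> [p|z Xz]; first by rewrite -(perm_mem RR'); exact: RG.
by rewrite -(perm_big _ RR') RS.
Qed.

(** * Norm descent on splittings *)

Lemma sum_unit_vectors (d n : nat) (A : 'M[int]_(d, n))
    (G : {fset 'cV[int]_d}) (z : 'cV[int]_n) :
  (forall j, A *m delta_mx j 0 \in G) ->
  (forall j, - (A *m delta_mx j 0) \in G) ->
  exists2 s, forall x, x \in s -> A *m x \in G & \sum_(x <- s) x = z.
Proof.
move=> Gp Gn; pose P v := exists2 s, forall x, x \in s -> A *m x \in G &
  \sum_(x <- s) x = v.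
have P0 : P 0 by exists [::]; rewrite ?big_nil.
have PD u v : P u -> P v -> P (u + v).
  move=> [s sG <-] [t tG <-]; exists (s ++ t); rewrite ?big_cat //.
  by move=> x; rewrite mem_cat => /orP[/sG|/tG].
have P1 v : A *m v \in G -> P v.
  move=> vG; exists [:: v]; last by rewrite big_seq1.
  by move=> x; rewrite inE => /eqP->.
have PM v m : P v -> P (v *+ m).
  by move=> Pv; elim: m => [|m IH]; rewrite ?mulr0n // mulrS; exact: PD.
change (P z); rewrite [z]matrix_sum_delta.
elim/big_ind: _ => // j _; rewrite big_ord1.
case: (z j 0) => m; first by rewrite -natz scaler_nat; exact/PM/P1.
rewrite NegzE scaleNr -natz scaler_nat -mulNrn; apply/PM/P1.
by rewrite mulmxN.
Qed.

Lemma resolvable_reduction (d n : nat) (A : 'M[int]_(d, n))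
    (G : {fset 'cV[int]_d}) (b : 'cV[int]_d) :
  0 \in G ->
  (forall j, A *m delta_mx j 0 \in G) ->
  (forall j, - (A *m delta_mx j 0) \in G) ->
  {in G &, forall f g, resolvable A G (f + g)} ->
  b <> 0 -> extfiber A b !=set0 ->
  exists2 g, g \in G /\ g <> 0 & reduces A b g.
Proof.
move=> G0 Gp Gn GD b0 [z0 bz0].
have [L LX Lb] := sqle_basis (extfiber A b).
pose cost R := (\sum_(z <- L) \sum_(p <- R)
  l1 ((p : 'cV[int]_d * ('cV[int]_n -> 'cV[int]_n)).2 z))%N.
suff h m R : splits A G [set` L] R -> (cost R < m)%N ->
    exists2 g, g \in G /\ g <> 0 & reduces A b g.
  have [s sG sz0] := sum_unit_vectors z0 Gp Gn.
  (* Every point shares the unit-vector decomposition of [z0]; the difference [z - z0] lies in the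
     kernel of [A] and is absorbed by a summand [0]. *)
  pose R := (0, fun z => z - z0) :: [seq (A *m x, fun=> x) | x <- s].
  apply: (h (cost R).+1 R) => //; split=> [p|z _].
    rewrite inE => /orP[/eqP->|/mapP[x xs ->]] /=; last by split=> //; exact: sG.
    by split=> // z /LX zb; rewrite mulmxBr zb bz0 subrr.
  by rewrite big_cons big_map /= sz0 subrK.
elim: m R => // m IH R RS Rm.
have [z1 z1L _] := Lb z0 bz0.
(* The summands add up to [b], which is nonzero, so they cannot all vanish. *)
have [p pR p0] : exists2 p, p \in R & p.1 <> 0.
  apply: contrapT => np; apply: b0; rewrite -(LX z1 z1L) -(RS.2 z1 z1L).
  rewrite mulmx_sumr big1_seq // => p /= pR; rewrite (RS.1 p pR).2 //.
  by apply: contrapT => p0; apply: np; exists p.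
have {}RS := splits_perm (perm_to_rem pR) RS.
have {Rm} : (cost (p :: rem p R) < m.+1)%N.
  rewrite (leq_trans _ Rm) // ltnS; apply: leq_sum => z _.
  by rewrite (perm_big _ (perm_to_rem pR)).
move: (rem p R) RS => S RS Rm; have [pG pA] := RS.1 p (mem_head _ _).
(* Either [p] cancels against no other summand at any minimal point, so that [p.1] reduces [b], or
   some [q] loses norm against [p] at some [z]. *)
have [q_sign|] := EM (forall q z, q \in S -> z \in L ->
    (l1 (p.2 z) + l1 (q.2 z) <= l1 (p.2 z + q.2 z))%N).
  exists p.1 => //; apply/reducesP => z /Lb[w wL wz].
  exists (p.2 w); first exact: pA.
  apply: sqle_trans wz; rewrite -[X in sqle _ X](RS.2 w wL) big_cons.
  apply: sqle_addr => j; rewrite summxE mulr_sumr big_seq.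
  by apply: sumr_ge0 => q qS; apply: l1D_sign; exact: q_sign.
move=> /existsNP[q] /existsNP[z] /not_implyP[qS] /not_implyP[zL] /negP.
rewrite -ltnNge => ltz.
have /(splits_perm)/(_ RS) {}RS : perm_eq (p :: S) (p :: q :: rem q S).
  by rewrite perm_cons perm_to_rem.
have {Rm} : (cost (p :: q :: rem q S) < m.+1)%N.
  rewrite (leq_trans _ Rm) // ltnS; apply: leq_sum => w _.
  by rewrite !big_cons (perm_big _ (perm_to_rem qS)) big_cons.
move: (rem q S) RS => T RS Rm {S qS}.
have [qG qA] : q.1 \in G /\ forall z, [set` L] z -> A *m q.2 z = q.1.
  by apply: RS.1; rewrite !inE eqxx orbT.
have [H [HG HS] Hl] := GD _ _ pG qG.
have pqA w : w \in L -> A *m (p.2 w + q.2 w) = p.1 + q.1.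
  by move=> wL; rewrite mulmxDr pA // qA.
(* The pair [p], [q] is replaced by the splitting of [p.1 + q.1], evaluated at the sum of their
   components. *)
apply: (IH ([seq (h.1, fun z => h.2 (p.2 z + q.2 z)) | h <- H] ++ T)).
  split=> [r|w wL].
    rewrite mem_cat => /orP[/mapP[h hH ->] /=|rT].
      have [hG hA] := HG h hH; split=> // w wL; apply: hA; exact: pqA.
    by apply: RS.1; rewrite !inE rT !orbT.
  rewrite big_cat big_map /= HS; last exact: pqA.
  by rewrite -addrA -[RHS](RS.2 w wL) !big_cons.
rewrite -ltnS; apply: leq_trans Rm.
have lew w : w \in L -> (\sum_(h <- H) l1 (h.2 (p.2 w + q.2 w)%R) <=
    l1 (p.2 w + q.2 w)%R)%N by move=> wL; apply: Hl; exact: pqA.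
(* The point [z] is isolated to get a strict drop; at the other minimal points the triangle
   inequality suffices. *)
rewrite /cost !(perm_big _ (perm_to_rem zL)) !big_cons /= -!addSn.
rewrite big_cat big_map /= addnA -!addSn.
apply: leq_add.
  by rewrite leq_add2r; apply: leq_ltn_trans ltz; exact: lew.
rewrite 2!(big_seq _ _ (rem z L)); apply: leq_sum => w wL.
rewrite big_cat big_map !big_cons addnA leq_add2r.
by apply: leq_trans (l1D _ _); apply/lew/(mem_rem wL).
Qed.

Lemma atomic_mem (d n : nat) (A : 'M[int]_(d, n))
    (G : {fset 'cV[int]_d}) (b : 'cV[int]_d) :
  0 \in G ->
  (forall j, A *m delta_mx j 0 \in G) ->
  (forall j, - (A *m delta_mx j 0) \in G) ->
  {in G &, forall f g, resolvable A G (f + g)} ->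
  atomic A b -> b \in G.
Proof.
move=> G0 Gp Gn GD bA; have [->//|b0] := EM (b = 0).
have [|bn0] := EM (extfiber A b !=set0); last first.
  (* An empty fiber decomposes vacuously, and [0] differs from [b]. *)
  case: bA; exists 0, 0; split; [exact/nesym|exact/nesym|] => z bz.
  by case: bn0; exists z.
move=> /(resolvable_reduction G0 Gp Gn GD b0)[g [gG g0] bg].
apply: contrapT => nbG; apply: bA; exists g, (b - g); split=> //.
  by move=> gb; rewrite gb in gG.
by move=> /eqP; rewrite -subr_eq0 addrAC subrr sub0r oppr_eq0 => /eqP.
Qed.

(** * Termination *)

Lemma normalForm_acc (d n : nat) (A : 'M[int]_(d, n))
    (G C : {fset 'cV[int]_d}) (z : 'cV[int]_n) :
  0 \notin G -> Acc (fun y x => step A x y) (Loop G C) ->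
  (forall w, (forall g, g \in G -> ~ reduces A (A *m w) g) -> A *m w <> 0 ->
    let G' := (A *m w |` G)%fset in
    Acc (fun y x => step A x y)
      (Loop G' (C `|` [fset (A *m w + g)%R | g in G'])%fset)) ->
  Acc (fun y x => step A x y) (NormalForm G C (A *m z)).
Proof.
move=> G0 accC accG; have [m] := ubnP (l1 z).
elim: m z => [z /[!ltn0] h|m IH z zm]; first discriminate h.
split=> y st; inversion st as [|? ? s g gG sg|? ? f irr f0|? ? f irr f0 G'|].
  (* The preimage [z] of the current value passes to [z - w]. Its norm drops strictly: [w] is
     nonzero because [0] is not in [G]. *)
  have /reducesP/(_ z erefl)[w Aw wz] := sg; rewrite -Aw -mulmxBr; apply: IH.
  have : l1 w <> 0%N by move=> /l1_eq0 w0; rewrite -Aw w0 mulmx0 (negPf G0) in gG.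
  move: zm; rewrite (l1_sqle wz) ltnS => zm w0; apply: leq_trans zm.
  rewrite -[ltnLHS]add0n ltn_add2r lt0n; exact/eqP.
  exact: accC.
exact: accG.
Qed.

(** Nested induction: an added element is reduced by no member of [G], so [G] undergoes a bad
    extension; while [G] stays fixed, [C] shrinks. Preimages under [A] are carried along because
    [normalForm_acc] measures them. *)
Lemma loop_acc (d n : nat) (A : 'M[int]_(d, n)) (G C : {fset 'cV[int]_d}) :
  0 \notin G -> (forall s, s \in G \/ s \in C -> exists z, s = A *m z) ->
  Acc (fun y x => step A x y) (Loop G C).
Proof.
have wf := @bad_extension_wf _ (fun g s => reduces A s g) (@reduces_good _ _ A).
elim/(well_founded_ind (wf_inverse_image _ _ _
  (fun G : {fset 'cV_d} => [set` G]) wf)): G C => G IH C G0.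
have [m] := ubnP #|` C|; elim: m C => [C /[!ltn0] h|m IHm C Cm GC]; first discriminate h.
split=> y st; inversion st as [? ? s sC| | | |]; last by split=> ? st'; inversion st'.
have [z sz] := GC s (or_intror sC).
have GCs t : t \in G \/ t \in (C `\ s)%fset -> exists z, t = A *m z.
  by case=> [tG|/fsetD1P[_ tC]]; apply: GC; [left|right].
rewrite sz; apply: normalForm_acc; first exact: G0; rewrite -sz.
  apply: IHm; last exact: GCs.
  by move: Cm; rewrite (cardfsD1 s C) sC; lia.
move=> w irr w0; apply: IH.
- split=> [x /= xG|]; first by rewrite !inE xG orbT.
  exists (A *m w) => /=; first by rewrite !inE eqxx.
  by move=> x /irr.
- by rewrite !inE negb_or G0 andbT; apply/eqP/nesym.
have G'z t : t \in (A *m w |` G)%fset -> exists z, t = A *m z.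
  by move=> /fset1UP[->|tG]; [exists w|apply: GC; left].
move=> t [/G'z//|/fsetUP[tC|/imfsetP[g /= /G'z[v ->] ->]]].
  by apply: GCs; right.
by exists (w + v); rewrite mulmxDr.
Qed.

Lemma mem_input (d n : nat) (A : 'M[int]_(d, n)) (f : 'cV[int]_d) :
  f \in input A <->
  f <> 0 /\ exists j, f = A *m delta_mx j 0 \/ f = - (A *m delta_mx j 0).
Proof.
split=> [/fsetD1P[/eqP f0 /fsetUP fj]|[/eqP f0 [j fj]]].
  by split=> //; case: fj => /imfsetP[j _ fj]; exists j; [left|right].
apply/fsetD1P; split=> //; apply/fsetUP.
by case: fj => ->; [left|right]; apply/imfsetP; exists j.
Qed.

Lemma completion_terminates (d n : nat) (A : 'M[int]_(d, n)) : terminates A.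
Proof.
have inputP f : f \in input A -> exists z, f = A *m z.
  move=> /mem_input[_ [j [->|->]]]; first by exists (delta_mx j 0).
  by exists (- delta_mx j 0); rewrite mulmxN.
apply: loop_acc; first by apply/negP => /mem_input[].
move=> s [/inputP//|/imfset2P[f /= /inputP[u ->] [g /= /inputP[v ->] ->]]].
by exists (u + v); rewrite mulmxDr.
Qed.

(** * Invariant of the algorithm and correctness *)

(* A pair whose sum is being normalized is only conditionally resolvable: any
   later set that resolves the current value [s] resolves the sum. *)
Definition completion_inv (d n : nat) (A : 'M[int]_(d, n)) (x : state d) : Prop :=
  match x with
  | Loop G C => (input A `<=` G)%fset /\ {in G &, forall f g,
      f + g \in C \/ resolvable A (0 |` G)%fset (f + g)}
  | NormalForm G C s => (input A `<=` G)%fset /\ {in G &, forall f g,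
      f + g \in C \/ forall G', ((0 |` G) `<=` G')%fset ->
        resolvable A G' s -> resolvable A G' (f + g)}
  | Return G => [/\ 0 \in G, (input A `<=` G)%fset &
      {in G &, forall f g, resolvable A G (f + g)}]
  end.

(** The condition on a pending pair starts out trivial, as [s] is the sum itself, and is discharged
    at the end: the normal form is [0] or has just joined [G], so it is resolved by membership. *)
Lemma completion_inv_step (d n : nat) (A : 'M[int]_(d, n)) (x y : state d) :
  step A x y -> completion_inv A x -> completion_inv A y.
Proof.
case=> {x y} [G C s sC|G C s g gG sg|G C _ _ ->|G C s irr s0 G'|G] /= [FG GP].
- split=> // f g fG gG; have [fgC|fgR] := GP f g fG gG.
    have [->|fgs] := eqVneq (f + g) s; first by right.
    by left; rewrite !inE fgs.
  by right=> G' GG' _; exact: resolvable_sub fgR.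
- split=> // f h fG hG; have [|fhR] := GP f h fG hG; first by left.
  right=> G' GG' sR; apply: fhR => //; apply: resolvable_reduces sg sR.
  by apply: (fsubsetP GG'); rewrite !inE gG orbT.
- split=> // f g fG gG; have [|fgR] := GP f g fG gG; first by left.
  by right; apply: fgR => //; apply: resolvable_mem; rewrite !inE eqxx.
- have GG' : (G `<=` G')%fset by exact: fsubsetU1.
  split; first exact: fsubset_trans FG GG'.
  have new f : f \in G' -> s + f \in (C `|` [fset (s + g)%R | g in G'])%fset.
    by move=> fG'; apply/fsetUP; right; apply/imfsetP; exists f.
  move=> f g; rewrite !(in_fset1U s G) => /orP[/eqP->|fG] /orP[/eqP->|gG].
  + by left; apply: new; rewrite !inE eqxx.
  + by left; apply: new; rewrite !inE gG orbT.
  + by left; rewrite addrC; apply: new; rewrite !inE fG orbT.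
  have [fgC|fgR] := GP f g fG gG; first by left; rewrite in_fsetU fgC.
  right; apply: fgR; first exact: fsetUS.
  by apply: resolvable_mem; rewrite !inE eqxx orbT.
- split; first by rewrite !inE eqxx.
    exact: fsubset_trans FG (fsubsetU1 _ _).
  move=> f g; rewrite !(in_fset1U 0 G) => /orP[/eqP->|fG] /orP[/eqP->|gG].
  + by rewrite addr0; apply: resolvable_mem; rewrite !inE eqxx.
  + by rewrite add0r; apply: resolvable_mem; rewrite !inE gG orbT.
  + by rewrite addr0; apply: resolvable_mem; rewrite !inE fG orbT.
  by have [|] := GP f g fG gG.
Qed.

Lemma completion_inv_reachable (d n : nat) (A : 'M[int]_(d, n)) (x : state d) :
  reachable A x -> completion_inv A x.
Proof.
move=> Ax; have: completion_inv A (init A).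
  split=> // f g fF gF; left; apply/imfset2P.
  by exists f => //; exists g.
by elim: Ax => [? ? /completion_inv_step|//|? ? ? _ h1 _ h2 /h1/h2]; exact.
Qed.

Lemma halted_return (d n : nat) (A : 'M[int]_(d, n)) (x : state d) :
  halted A x -> exists G, x = Return G.
Proof.
case: x => [G C|G C s|G] hx; last by exists G.
  have [C0|[s sC]] := fset_0Vmem C; last by case: (hx _ (StepChoose A G sC)).
  by rewrite C0 in hx; case: (hx _ (StepReturn A G)).
have [irr|] := EM (forall g, g \in G -> ~ reduces A s g); last first.
  move=> /existsNP[g] /not_implyP[gG] /contrapT sg.
  by case: (hx _ (StepReduce C gG sg)).
have [s0|s0] := EM (s = 0); first by case: (hx _ (StepZero C irr s0)).
by case: (hx _ (StepAdd C irr s0)).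
Qed.

Theorem lemma4p3 (d n : nat) (A : 'M[int]_(d, n)) :
  terminates A /\
  (forall x : state d, reachable A x -> halted A x ->
     exists2 G : {fset 'cV[int]_d}, x = Return G &
       [set extfiber A b | b in atomic A]
         `<=` [set extfiber A b | b in [set` G]]).
Proof.
split=> [|x /completion_inv_reachable + /halted_return[G xG]].
  exact: completion_terminates.
rewrite xG => -[G0 /fsubsetP FG GD]; exists G => // _ [b bA <-]; exists b => //=.
have inG f j : f = A *m delta_mx j 0 \/ f = - (A *m delta_mx j 0) -> f \in G.
  (* [input] omits [0], so columns of [A] that vanish are covered by the final insertion of [0]. *)
  have [->//|/eqP f0 fj] := eqVneq f 0.
  by apply/FG/mem_input; split=> //; exists j.
by apply: atomic_mem bA => // j; apply: inG; [left|right].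
Qed.
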